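(* Let $d\in\mathbb{N}$. The ring $\mathcal{S}'(\mathbb{Z}^d)$ is a pre-Bézout ring.
   Context: $\mathbb{N}=\{1,2,3,\dots\}$. For $\mathbf{n}=(n_1,\dots,n_d)\in\mathbb{Z}^d$ write $|\mathbf{n}|_1:=|n_1|+\cdots+|n_d|$. The set $\mathcal{S}'(\mathbb{Z}^d)$ consists of all maps $\mathbf{a}:\mathbb{Z}^d\to\mathbb{C}$ of at most polynomial growth, i.e. such that there exist a real $M>0$ and $k\in\mathbb{N}$ with $|\mathbf{a}(\mathbf{n})|\le M(1+|\mathbf{n}|_1)^k$ for all $\mathbf{n}\in\mathbb{Z}^d$. With pointwise addition and multiplication it is a commutative unital ring. In a commutative ring $R$, $d$ divides $a$ (written $d|a$) if there is $\alpha\in R$ with $d\alpha=a$. An element $d\in R$ is a greatest common divisor (gcd) of $a,b\in R$ if $d|a$, $d|b$, and whenever $d'\in R$ satisfies $d'|a$ and $d'|b$, then $d'|d$. A commutative ring $R$ is pre-Bézout if for all $a,b\in R$ possessing a gcd $d$, there exist $x,y\in R$ such that $d=xa+yb$. *)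

(* Defs.v *)
From HB Require Import structures.
From mathcomp Require Import all_boot all_order all_algebra.
From mathcomp Require Import boolp classical_sets functions reals complex.

Set Implicit Arguments.
Unset Strict Implicit.
Unset Printing Implicit Defensive.

Import Order.TTheory GRing.Theory Num.Theory.
Local Open Scope ring_scope.
Local Open Scope complex_scope.

Section CommutativeRings.
Variable A : comPzRingType.
Implicit Types a b d : A.

Definition divides d a : Prop := exists c : A, d * c = a.

Definition is_gcd d a b : Prop :=
  [/\ divides d a, divides d b &
      forall d' : A, divides d' a -> divides d' b -> divides d' d].

End CommutativeRings.

Definition pre_Bezout (A : comPzRingType) : Prop :=
  forall a b d : A, is_gcd d a b -> exists x y : A, d = x * a + y * b.

Definition norm1 (d : nat) (n : 'rV[int]_d) : nat := \sum_(i < d) `|n ord0 i|%N.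

Section Tempered.
Variables (R : realType) (d : nat).

(* The norm of R[i] takes values in R[i], hence the embedding M%:C. *)
Definition poly_growth (a : 'rV[int]_d -> R[i]) : Prop :=
  exists (M : R) (k : nat), [/\ 0 < M, (0 < k)%N &
    forall n, `|a n| <= M%:C * (1 + (norm1 n)%:R) ^+ k].

Definition tempered : {pred 'rV[int]_d -> R[i]} := fun a => `[< poly_growth a >].

Lemma temperedP (a : 'rV[int]_d -> R[i]) :
  reflect (poly_growth a) (a \in tempered).
Proof. exact: asboolP. Qed.

Lemma tempered_subring_closed : subring_closed tempered.
Proof.
have ge1 (n : 'rV[int]_d) : 1 <= 1 + (norm1 n)%:R :> R[i].
  by rewrite lerDl ler0n.
have ge0 (n : 'rV[int]_d) k : 0 <= (1 + (norm1 n)%:R) ^+ k :> R[i].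
  by rewrite exprn_ge0// addr_ge0// ler0n.
split=> [|a b /temperedP[M [k [M0 k0 aM]]] /temperedP[N [l [N0 l0 bN]]]
         |a b /temperedP[M [k [M0 k0 aM]]] /temperedP[N [l [N0 l0 bN]]]];
  apply/temperedP.
- exists 1, 1%N; split=> // n.
  by rewrite mul1r expr1 normr1.
- exists (M + N), (k + l)%N; split; [exact: addr_gt0 | by rewrite addn_gt0 k0|].
  move=> n; apply: le_trans (ler_normB _ _) _.
  rewrite rmorphD/= mulrDl; apply: lerD.
    apply: le_trans (aM n) _; apply: ler_wpM2l; first by rewrite lecR ltW.
    by apply: ler_weXn2l => //; rewrite leq_addr.
  apply: le_trans (bN n) _; apply: ler_wpM2l; first by rewrite lecR ltW.
  by apply: ler_weXn2l => //; rewrite leq_addl.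
- exists (M * N), (k + l)%N; split; [exact: mulr_gt0 | by rewrite addn_gt0 k0|].
  move=> n; rewrite normrM rmorphM/= exprD mulrACA.
  exact: ler_pM.
Qed.

Record tempered_map := TemperedMap {
  tempered_val :> 'rV[int]_d -> R[i];
  tempered_valP : tempered_val \in tempered
}.

HB.instance Definition _ := [isSub for tempered_val].
HB.instance Definition _ := [Choice of tempered_map by <:].
HB.instance Definition _ :=
  GRing.SubChoice_isSubComPzRing.Build _ _ tempered_map tempered_subring_closed.

End Tempered.

(* The ring operations inherited from the function space are the pointwise ones. *)
Lemma tempered_mapE (R : realType) (d : nat) (a b : tempered_map R d) n :
  [/\ (a + b) n = a n + b n, (a * b) n = a n * b n,
      (- a) n = - a n, (0 : tempered_map R d) n = 0 &
      (1 : tempered_map R d) n = 1].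
Proof. by []. Qed.

(* Main.v *)
(* The ring is even Bezout: |a| + |b| = u a + v b for the phases u = |a|/a and
   v = |b|/b, and |a| + |b| divides a and b because the pointwise quotients are
   bounded by 1. Hence |a| + |b| divides every gcd of a and b. *)
Require Import Defs.
From mathcomp Require Import all_boot all_order all_algebra.
From mathcomp Require Import boolp classical_sets functions reals complex.

Import Order.TTheory GRing.Theory Num.Theory.
Local Open Scope ring_scope.

Lemma le1_tempered (R : realType) (d : nat) (f : 'rV[int]_d -> R[i]) :
  (forall n, `|f n| <= 1) -> f \in @tempered R d.
Proof.
move=> f1; apply/temperedP; exists 1, 1%N; split=> // n.
by rewrite mul1r expr1 (le_trans (f1 n))// lerDl ler0n.
Qed.

(** The cofactor is the pointwise quotient. At a zero of [e] it is 0, since [0^-1 = 0], and the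
    bound forces [a n = 0] there too. *)
Lemma le_norm_divides (R : realType) (d : nat) (a e : tempered_map R d) :
  (forall n, `|a n| <= `|e n|) -> divides e a.
Proof.
move=> ae.
have q1 n : `|a n / e n| <= 1.
  have [->|e0] := eqVneq (e n) 0; first by rewrite invr0 mulr0 normr0.
  by rewrite normrM normfV ler_pdivrMr ?normr_gt0// mul1r.
exists (TemperedMap (le1_tempered _ _ _ q1)).
apply: val_inj; apply/funext => n; rewrite -[LHS]/(e n * (a n / e n)) mulrC.
have [e0|e0] := eqVneq (e n) 0; last by rewrite divfK.
by apply/esym/eqP; have := ae n; rewrite e0 mulr0 normr0 normr_le0.
Qed.

(** The phase [|a n| / a n] has modulus 1 off the zeros of [a] and is 0 on them, hence is
    tempered. *)
Lemma tempered_phase (R : realType) (d : nat) (a : tempered_map R d) :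
  exists u : tempered_map R d, forall n, (u * a) n = `|a n|.
Proof.
have u1 n : `| `|a n| / a n| <= 1.
  have [->|a0] := eqVneq (a n) 0; first by rewrite invr0 mulr0 normr0.
  by rewrite normrM normfV normr_id divff ?normr_eq0.
exists (TemperedMap (le1_tempered _ _ _ u1)) => n.
rewrite -[LHS]/(`|a n| / a n * a n).
have [->|a0] := eqVneq (a n) 0; first by rewrite mulr0 normr0.
by rewrite divfK.
Qed.

Theorem theorem7p1 (R : realType) (d : nat) (hd : (0 < d)%N) :
  pre_Bezout (tempered_map R d).
Proof.
move=> a b g [_ _ gcdP].
have [u ua] := tempered_phase _ _ a.
have [v vb] := tempered_phase _ _ b.
have normE n : `|(u * a + v * b) n| = `|a n| + `|b n|.
  have [abE _ _ _ _] := tempered_mapE (u * a) (v * b) n.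
  (* The value is a nonnegative real, so the outer norm drops. *)
  by rewrite abE ua vb ger0_norm; last by rewrite addr_ge0.
(* Being a common divisor, [u * a + v * b] divides [g]; the cofactor [c] scales [u] and [v] into the
   coefficients. *)
have [||c <-] := gcdP (u * a + v * b).
- by apply: le_norm_divides => n; rewrite normE lerDl.
- by apply: le_norm_divides => n; rewrite normE lerDr.
by exists (c * u), (c * v); rewrite mulrC mulrDr !mulrA.
Qed.
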